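(* Let $a,b,c$ be real numbers. Let $\epsilon_{i,j}$, $i,j\in\mathbb{Z}$, be uncorrelated zero-mean equal-variance random variables, $\mathsf{E}\epsilon_{i,j}=0$ and $\mathsf{E}\epsilon_{i,j}^2=\sigma_\epsilon^2$, $0<\sigma_\epsilon^2<\infty$. Let $X=\{X_{i,j},\ i,j\in\mathbb{Z}\}$ be a wide-sense stationary field satisfying $$X_{i,j}=aX_{i-1,j}+bX_{i,j-1}+cX_{i-1,j-1}+\epsilon_{i,j}\qquad\text{for all } i,j\in\mathbb{Z}.$$ Then $X$ is causal with respect to the white noise $\epsilon$ if and only if the following four inequalities hold: $$1-a-b-c>0,\quad 1-a+b+c>0,\quad 1+a-b+c>0,\quad 1+a+b-c>0.$$ If the field $X$ is causal, then the coefficients $\psi_{k,l}$ ($k,l\ge 0$) in the representation $X_{i,j}=\sum_{k=0}^\infty\sum_{l=0}^\infty\psi_{k,l}\epsilon_{i-k,j-l}$ equal $$\psi_{k,l}=\sum_{m=0}^{\min(k,l)}\binom{k}{m}\binom{l}{m}a^{k-m}b^{l-m}(ab+c)^m.$$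
   Context: All random variables are real-valued. A random field is wide-sense stationary if it has finite second moments, constant mean, and $\operatorname{cov}(X_{i,j},X_{i-h_1,j-h_2})$ depends only on $(h_1,h_2)$. A random field $X$ is called causal with respect to the white noise $\epsilon$ if there exists an array of coefficients $\{\psi_{k,l},\ k,l=0,1,2,\ldots\}$ with $\sum_{k=0}^\infty\sum_{l=0}^\infty|\psi_{k,l}|<\infty$ such that $X_{i,j}=\sum_{k=0}^\infty\sum_{l=0}^\infty\psi_{k,l}\epsilon_{i-k,j-l}$ for all $i,j\in\mathbb{Z}$ (the series converges in mean square and almost surely; equality is almost sure). The convention $0^0=1$ is used. *)

(* Defs.v *)
From HB Require Import structures.
From mathcomp Require Import all_boot all_order all_algebra.
From mathcomp Require Import all_classical all_reals all_analysis.

Set Implicit Arguments.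
Unset Strict Implicit.
Unset Printing Implicit Defensive.

Import Order.TTheory GRing.Theory Num.Theory.
Import numFieldNormedType.Exports.

Local Open Scope classical_set_scope.
Local Open Scope ring_scope.

Definition white_noise (d : measure_display) (T : measurableType d)
    (R : realType) (P : probability T R) (eps : int -> int -> {RV P >-> R})
    (sigma2 : R) : Prop :=
  [/\ forall i j, 'E_P[eps i j]%E = 0%:E,
      forall i j, 'E_P[fun w => (eps i j w ^+ 2)%R]%E = sigma2%:E &
      forall i j i' j', (i, j) != (i', j') ->
        covariance P (eps i j) (eps i' j') = 0%:E].

Definition wide_sense_stationary (d : measure_display) (T : measurableType d)
    (R : realType) (P : probability T R) (X : int -> int -> {RV P >-> R})
    : Prop :=
  [/\ forall i j, ('E_P[fun w => (X i j w ^+ 2)%R] < +oo)%E,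
      forall i j i' j', 'E_P[X i j]%E = 'E_P[X i' j']%E &
      forall h1 h2 i j i' j',
        covariance P (X i j) (X (i - h1) (j - h2)) =
        covariance P (X i' j') (X (i' - h1) (j' - h2))].

Definition absolutely_summable (R : realType) (psi : nat -> nat -> R) : Prop :=
  (\sum_(0 <= k <oo) \sum_(0 <= l <oo) `|psi k l|%:E < +oo)%E.

Definition ma_partial_sum (d : measure_display) (T : measurableType d)
    (R : realType) (P : probability T R) (eps : int -> int -> {RV P >-> R})
    (psi : nat -> nat -> R) (i j : int) (m n : nat) (w : T) : R :=
  \sum_(k < m) \sum_(l < n) psi k l * eps (i - k%:Z) (j - l%:Z) w.

(* Both modes of convergence are those of the rectangular partial sums, the
   two bounds tending to infinity independently. For absolutely summable [psi]
   and white noise [eps] the double series converges absolutely almost surely,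
   so every order of summation, iterated or not, gives the same limit. *)
Definition causal_representation (d : measure_display) (T : measurableType d)
    (R : realType) (P : probability T R) (X eps : int -> int -> {RV P >-> R})
    (psi : nat -> nat -> R) : Prop :=
  absolutely_summable psi /\
  forall i j : int,
    ('E_P[fun w => ((ma_partial_sum eps psi i j mn.1 mn.2 w - X i j w) ^+ 2)%R]%E
       @[mn --> (\oo, \oo)] --> 0%:E) /\
    {ae P, forall w,
      ma_partial_sum eps psi i j mn.1 mn.2 w @[mn --> (\oo, \oo)] --> X i j w}.

Definition causal (d : measure_display) (T : measurableType d)
    (R : realType) (P : probability T R) (X eps : int -> int -> {RV P >-> R})
    : Prop :=
  exists psi : nat -> nat -> R, causal_representation X eps psi.

(* Main.v *)
Require Import Defs.
From HB Require Import structures.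
From mathcomp Require Import all_boot all_order all_algebra.
From mathcomp Require Import all_classical all_reals all_analysis.
From mathcomp Require Import measurable_realfun.
From mathcomp Require Import ring lra zify.
Import Order.TTheory GRing.Theory Num.Theory.
Import numFieldNormedType.Exports.
Local Open Scope classical_set_scope.
Local Open Scope ring_scope.

(* Testing the equation against [eps (i - k) (j - l)] shows that the coefficients
   of a causal representation satisfy the recursion
   psi(k,l) = a psi(k-1,l) + b psi(k,l-1) + c psi(k-1,l-1) + [k = l = 0],
   whose only solution is the binomial formula. Absolute summability then forces
   1 - a z - b w - c z w to have no zero with z, w in [-1, 1], since the partial
   sums of psi(k,l) z^k w^l would otherwise reproduce 1 from boundary terms that
   tend to 0; by continuity from (0, 0) it is positive at the four corners.

   Conversely, with H(k,l) = psi(k,l) - b psi(k,l-1) and V(k,l) = psi(k,l-1), the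
   recursion is the first-order system H(k+1,l) = a H + (a b + c) V,
   V(k,l+1) = H + b V. The four inequalities provide p > 0 such that p H^2 + V^2,
   summed along antidiagonals, contracts by a factor theta < 1; hence psi decays
   geometrically. Summation by parts expresses X minus a rectangular partial sum
   through the values of X on the far sides of the rectangle, weighted by H and
   V, and the random series of the r^(k+l) X_(i-k,j-l)^2, which is integrable
   because second moments are bounded, dominates this remainder both almost
   surely and in mean square. *)

(** * Closed form and recursion of the coefficients *)

Definition ar_coef {R : comNzRingType} (a b c : R) (k l : nat) : R :=
  \sum_(m < (minn k l).+1) 'C(k, m)%:R * 'C(l, m)%:R * a ^+ (k - m)
    * b ^+ (l - m) * (a * b + c) ^+ m.

(** The clauses spell out the recursion with [psi] read as 0 at negative indices. *)
Definition ar_recursion {R : comNzRingType} (a b c : R) (psi : nat -> nat -> R)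
    : Prop :=
  [/\ psi 0 0 = 1, forall k, psi k.+1 0 = a * psi k 0,
      forall l, psi 0 l.+1 = b * psi 0 l &
      forall k l, psi k.+1 l.+1 = a * psi k l.+1 + b * psi k.+1 l + c * psi k l].

(** Binomials vanish beyond [minn k l], so sums at neighbouring sites can share one range. *)
Lemma ar_coef_widen {R : comNzRingType} (a b c : R) (k l N : nat) :
  (minn k l <= N)%N ->
  ar_coef a b c k l = \sum_(0 <= m < N.+1) 'C(k, m)%:R * 'C(l, m)%:R
    * a ^+ (k - m) * b ^+ (l - m) * (a * b + c) ^+ m.
Proof.
move=> leN; rewrite [RHS](big_cat_nat (n := (minn k l).+1)) //=.
rewrite [X in _ + X]big_nat_cond [X in _ + X]big1 ?addr0 => [|m].
  by rewrite big_mkord.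
rewrite andbT => /andP[+ _]; rewrite gtn_min => /orP[] lt_m.
  by rewrite (bin_small lt_m) !mul0r.
by rewrite (bin_small lt_m) mulr0 !mul0r.
Qed.

(** Once [c] is written as [(a * b + c) - a * b], comparing the factors of each common monomial
    reduces to Pascal's rule for both binomials. *)
Lemma ar_coef_recursion {R : comNzRingType} (a b c : R) :
  ar_recursion a b c (ar_coef a b c).
Proof.
split=> [|k|l|k l].
- by rewrite /ar_coef big_ord1 !bin0 !expr0 !mulr1.
- rewrite /ar_coef !minn0 !big_ord1 !bin0 !subn0 !expr0 !mulr1 !mul1r.
  by rewrite exprS.
- rewrite /ar_coef !min0n !big_ord1 !bin0 !subn0 !expr0 !mulr1 !mul1r.
  by rewrite exprS.
pose N := (k + l).+1.
have le1 : (minn k.+1 l.+1 <= N)%N by rewrite /N; lia.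
have le2 : (minn k l.+1 <= N)%N by rewrite /N; lia.
have le3 : (minn k.+1 l <= N)%N by rewrite /N; lia.
have le4 : (minn k l <= N)%N by rewrite /N; lia.
have le5 : (minn k l <= k + l)%N by lia.
(* Common monomial of all five sums. When [m] exceeds [k] or [l], truncated subtraction may break
   the match of exponents, but a binomial is then 0. *)
pose w m := a ^+ (k.+1 - m) * b ^+ (l.+1 - m) * (a * b + c) ^+ m.
have e1 : ar_coef a b c k.+1 l.+1 =
    \sum_(0 <= m < N.+1) ('C(k.+1, m) * 'C(l.+1, m))%:R * w m.
  rewrite (ar_coef_widen _ _ _ _ _ N) //; apply: eq_bigr => m _.
  by rewrite natrM /w !mulrA.
have e2 : a * ar_coef a b c k l.+1 =
    \sum_(0 <= m < N.+1) ('C(k, m) * 'C(l.+1, m))%:R * w m.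
  rewrite (ar_coef_widen _ _ _ _ _ N) // mulr_sumr; apply: eq_bigr => m _.
  rewrite natrM /w; case: (leqP m k) => [lemk|/bin_small->]; last by rewrite !mul0r mulr0.
  by rewrite (subSn lemk) exprS; ring.
have e3 : b * ar_coef a b c k.+1 l =
    \sum_(0 <= m < N.+1) ('C(k.+1, m) * 'C(l, m))%:R * w m.
  rewrite (ar_coef_widen _ _ _ _ _ N) // mulr_sumr; apply: eq_bigr => m _.
  rewrite natrM /w; case: (leqP m l) => [leml|/bin_small->].
    by rewrite (subSn leml) [in RHS]exprS; ring.
  by rewrite mulr0 !mul0r mulr0.
have e4 : a * b * ar_coef a b c k l = \sum_(0 <= m < N.+1) ('C(k, m) * 'C(l, m))%:R * w m.
  rewrite (ar_coef_widen _ _ _ _ _ N) // mulr_sumr; apply: eq_bigr => m _.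
  rewrite natrM /w; case: (leqP m k) => [lemk|/bin_small->]; last by rewrite !mul0r mulr0.
  case: (leqP m l) => [leml|/bin_small->]; last by rewrite mulr0 !mul0r mulr0.
  by rewrite (subSn lemk) (subSn leml) 2!exprS; ring.
have e5 : (a * b + c) * ar_coef a b c k l =
    \sum_(0 <= m < N.+1) (if m is m'.+1 then 'C(k, m') * 'C(l, m') else 0)%:R * w m.
  rewrite (ar_coef_widen _ _ _ _ _ (k + l)) // [RHS]big_nat_recl // mul0r add0r.
  rewrite mulr_sumr; apply: eq_bigr => m _.
  by rewrite natrM /w !subSS exprS; ring.
have -> : a * ar_coef a b c k l.+1 + b * ar_coef a b c k.+1 l + c * ar_coef a b c k l =
    a * ar_coef a b c k l.+1 + b * ar_coef a b c k.+1 l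
    - a * b * ar_coef a b c k l + (a * b + c) * ar_coef a b c k l by ring.
rewrite e1 e2 e3 e4 e5 -sumrN -!big_split /=; apply: eq_bigr => -[|m] _.
  by rewrite !bin0; ring.
by rewrite !binS; ring.
Qed.

Lemma ar_recursion_unique {R : comNzRingType} (a b c : R)
    (psi phi : nat -> nat -> R) :
  ar_recursion a b c psi -> ar_recursion a b c phi -> forall k l, psi k l = phi k l.
Proof.
move=> [p00 p0 p1 p2] [q00 q0 q1 q2]; elim=> [|k IHk]; elim=> [|l IHl].
- by rewrite p00.
- by rewrite p1 q1 IHl.
- by rewrite p0 q0 IHk.
- by rewrite p2 q2 IHl !IHk.
Qed.

(** * First-order system and summation by parts *)

(** The value 0 at [l = 0] is [psi] at index -1, outside the quadrant. *)
Definition ar_vert {R : comNzRingType} (psi : nat -> nat -> R) (k l : nat) : R :=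
  if l is l'.+1 then psi k l' else 0.

Definition ar_hor {R : comNzRingType} (b : R) (psi : nat -> nat -> R)
    (k l : nat) : R :=
  psi k l - b * ar_vert psi k l.

Lemma ar_vertS {R : comNzRingType} (b : R) (psi : nat -> nat -> R) (k l : nat) :
  ar_vert psi k l.+1 = ar_hor b psi k l + b * ar_vert psi k l.
Proof. by rewrite /ar_hor subrK. Qed.

(** Along the edge [k = 0] the coefficients are powers of [b], so [ar_hor] starts as a unit mass at
    the origin. *)
Lemma ar_hor0 {R : comNzRingType} (a b c : R) (psi : nat -> nat -> R) (l : nat) :
  ar_recursion a b c psi -> ar_hor b psi 0 l = (l == 0)%:R.
Proof.
case=> p00 _ p1 _; case: l => [|l]; first by rewrite /ar_hor /= mulr0 subr0.
by rewrite /ar_hor /= p1 subrr.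
Qed.

Lemma ar_horS_psi {R : comNzRingType} (a b c : R) (psi : nat -> nat -> R)
    (k l : nat) : ar_recursion a b c psi ->
  ar_hor b psi k.+1 l = a * psi k l + c * ar_vert psi k l.
Proof.
case=> _ p0 _ p2; case: l => [|l]; first by rewrite /ar_hor /= p0 !mulr0 addr0 subr0.
by rewrite /ar_hor /= p2; ring.
Qed.

Lemma ar_horS {R : comNzRingType} (a b c : R) (psi : nat -> nat -> R)
    (k l : nat) : ar_recursion a b c psi ->
  ar_hor b psi k.+1 l = a * ar_hor b psi k l + (a * b + c) * ar_vert psi k l.
Proof. by move=> rec; rewrite (ar_horS_psi _ _ _ _ _ _ rec) /ar_hor; ring. Qed.

(* Summation by parts along a column, then telescoping over the columns. *)
Lemma ar_column_remainder {R : comNzRingType} (a b c : R)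
    (psi x e : nat -> nat -> R) (k n : nat) :
  ar_recursion a b c psi ->
  (forall k l, x k l = a * x k.+1 l + b * x k l.+1 + c * x k.+1 l.+1 + e k l) ->
  \sum_(l < n) psi k l * e k l =
    \sum_(l < n) ar_hor b psi k l * x k l
    - \sum_(l < n) ar_hor b psi k.+1 l * x k.+1 l
    - ar_vert psi k n * (b * x k n + c * x k.+1 n).
Proof.
move=> rec eqx; elim: n => [|n IHn]; first by rewrite !big_ord0 /= mul0r !subr0.
rewrite !big_ord_recr /= IHn (ar_horS_psi _ _ _ _ _ _ rec) /ar_hor.
have -> : e k n = x k n - a * x k.+1 n - b * x k n.+1 - c * x k.+1 n.+1.
  by rewrite (eqx k n); ring.
ring.
Qed.

(** Indices run into the past: [x k l] stands for X_(i-k,j-l). The identity is purely algebraic, so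
    it serves both a path of the field and the constant solution 1. *)
Lemma ar_remainder {R : comNzRingType} (a b c : R)
    (psi x e : nat -> nat -> R) (m n : nat) :
  ar_recursion a b c psi ->
  (forall k l, x k l = a * x k.+1 l + b * x k l.+1 + c * x k.+1 l.+1 + e k l) ->
  x 0%N 0%N - \sum_(k < m) \sum_(l < n.+1) psi k l * e k l =
    \sum_(l < n.+1) ar_hor b psi m l * x m l
    + \sum_(k < m) ar_vert psi k n.+1 * (b * x k n.+1 + c * x k.+1 n.+1).
Proof.
move=> rec eqx; elim: m => [|m IHm].
  (* With no column summed, the right side reduces to [x 0 0] by the unit mass of [ar_hor] at
     [l = 0], which the range [n.+1] always contains. *)
  rewrite !big_ord0 subr0 addr0 big_ord_recl (ar_hor0 _ _ _ _ _ rec) mul1r.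
  by rewrite big1 ?addr0 // => l _; rewrite (ar_hor0 _ _ _ _ _ rec) mul0r.
rewrite !(big_ord_recr m) /= opprD addrA IHm.
rewrite (ar_column_remainder _ _ _ _ _ _ m n.+1 rec eqx) /=; ring.
Qed.

(** * Quadratic Lyapunov form and geometric decay *)

Lemma lyapunov_contraction {R : realFieldType} (a b c : R) :
  0 < 1 - a - b - c -> 0 < 1 - a + b + c -> 0 < 1 + a - b + c ->
  0 < 1 + a + b - c ->
  exists p theta : R, [/\ 0 < p, 0 < theta, theta < 1 &
    forall h v, p * (a * h + (a * b + c) * v) ^+ 2 + (h + b * v) ^+ 2
                <= theta * (p * h ^+ 2 + v ^+ 2)].
Proof.
move=> h1 h2 h3 h4.
set d := a * b + c; pose M := 1 - a ^+ 2 - b ^+ 2 + c ^+ 2.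
have m1 : 0 < M - 2 * d.
  have -> : M - 2 * d = (1 - a - b - c) * (1 + a + b - c) by rewrite /M /d; ring.
  exact: mulr_gt0.
have m2 : 0 < M + 2 * d.
  have -> : M + 2 * d = (1 - a + b + c) * (1 + a - b + c) by rewrite /M /d; ring.
  exact: mulr_gt0.
have M0 : 0 < M by lra.
(* The determinant of the quadratic form below is [p * M - (p * d) ^+ 2 - 1]; as
   [4 * d ^+ 2 < M ^+ 2], the value [2 / M] lies strictly between its roots in [p] *)
pose p := 2 / M.
have p0 : 0 < p by rewrite divr_gt0.
have pM : p * M = 2 by rewrite /p divfK // gt_eqF.
(* The decrease [p h^2 + v^2 - p (a h + d v)^2 - (h + b v)^2] of the form equals
   [al h^2 - 2 be h v + ga v^2]. *)
pose al := p * (1 - a ^+ 2) - 1.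
pose be := p * a * d + b.
pose ga := 1 - b ^+ 2 - p * d ^+ 2.
have al0 : 0 < al.
  (* This quantity is half of the sum of the products in [s3] and [s4]. *)
  have q1 : 0 < 2 * (1 - a ^+ 2) - M.
    have s1 : 0 < (1 - a - b - c) * (1 + a + b - c) by exact: mulr_gt0.
    have s2 : 0 < (1 - a + b + c) * (1 + a - b + c) by exact: mulr_gt0.
    have s3 : 0 < (1 - a - b - c) * (1 + a - b + c) by exact: mulr_gt0.
    have s4 : 0 < (1 - a + b + c) * (1 + a + b - c) by exact: mulr_gt0.
    by rewrite /M; nra.
  have -> : al = (2 * (1 - a ^+ 2) - M) / M by rewrite /al /p; field; rewrite gt_eqF.
  exact: divr_gt0.
have det0 : 0 < al * ga - be ^+ 2.
  have -> : al * ga - be ^+ 2 = p * M - (p * d) ^+ 2 - 1.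
    by rewrite /al /ga /be /M /d; ring.
  have -> : p * M - (p * d) ^+ 2 - 1 = (M - 2 * d) * (M + 2 * d) / M ^+ 2.
    by rewrite /p; field; rewrite gt_eqF.
  by rewrite divr_gt0 ?exprn_gt0 ?mulr_gt0.
have ga0 : 0 < ga.
  by rewrite -(pmulr_rgt0 _ al0); have := sqr_ge0 be; lra.
(* Splitting [mu (p h^2 + v^2)] off the decrease leaves determinant
   [al ga - be^2 - mu (al + p ga) + mu^2 p]; this [mu] cancels all but [mu^2 p]. *)
pose mu := (al * ga - be ^+ 2) / (al + p * ga).
have D0 : 0 < al + p * ga by rewrite addr_gt0 // mulr_gt0.
have mu0 : 0 < mu by rewrite divr_gt0.
have muD : mu * (al + p * ga) = al * ga - be ^+ 2 by rewrite divfK // gt_eqF.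
have amp : 0 < al - mu * p.
  suff : 0 < (al - mu * p) * (al + p * ga) by rewrite pmulr_lgt0.
  have -> : (al - mu * p) * (al + p * ga) = al * (al + p * ga) - p * (mu * (al + p * ga)).
    by ring.
  rewrite muD.
  have -> : al * (al + p * ga) - p * (al * ga - be ^+ 2) = al * al + p * be ^+ 2 by ring.
  by rewrite ltr_pwDl ?mulr_gt0 // mulr_ge0 ?sqr_ge0 // ltW.
(* From [mu p < al < p]; it makes [theta = 1 - mu] positive. *)
have mu1 : mu < 1.
  have : al < p.
    have : 0 <= p * a ^+ 2 by rewrite mulr_ge0 ?sqr_ge0 // ltW.
    by rewrite /al; lra.
  move=> alp; have : mu * p < 1 * p by lra.
  by rewrite ltr_pM2r.
exists p, (1 - mu); split=> //; [lra|lra|] => h v.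
rewrite -subr_ge0.
set Q := _ - _.
have e : (al - mu * p) * Q = ((al - mu * p) * h - be * v) ^+ 2
   + (mu ^+ 2 * p) * v ^+ 2.
  transitivity (((al - mu * p) * h - be * v) ^+ 2
   + ((al - mu * p) * (ga - mu) - be ^+ 2) * v ^+ 2).
    by rewrite /Q /al /be /ga; ring.
  congr (_ + _ * _).
  have -> : (al - mu * p) * (ga - mu) - be ^+ 2 =
    (al * ga - be ^+ 2) - mu * (al + p * ga) + mu ^+ 2 * p by ring.
  by rewrite muD; ring.
rewrite -(pmulr_rge0 _ amp) e addr_ge0 ?sqr_ge0 // mulr_ge0 ?sqr_ge0 //.
by rewrite mulr_ge0 ?sqr_ge0 // ltW.
Qed.

(** The state at (k,l) feeds [ar_hor] at (k+1,l) and [ar_vert] at (k,l+1), both on the next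
    antidiagonal. The two entries fed by nothing, [ar_hor] at (0,n+1) and [ar_vert] at (n+1,0), are
    0. *)
Lemma ar_energy_decay {R : realFieldType} (a b c p theta : R)
    (psi : nat -> nat -> R) (n : nat) :
  0 <= theta ->
  (forall h v, p * (a * h + (a * b + c) * v) ^+ 2 + (h + b * v) ^+ 2
                <= theta * (p * h ^+ 2 + v ^+ 2)) ->
  ar_recursion a b c psi ->
  \sum_(0 <= k < n.+1) (p * ar_hor b psi k (n - k) ^+ 2
                     + ar_vert psi k (n - k) ^+ 2) <= p * theta ^+ n.
Proof.
move=> th0 contr rec; elim: n => [|n IHn].
  by rewrite big_nat1 (ar_hor0 _ _ _ _ _ rec) /= !expr0 expr1n expr0n /= addr0.
pose h k := ar_hor b psi k (n - k); pose v k := ar_vert psi k (n - k).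
rewrite big_split /= [X in X + _]big_nat_recl // [X in _ + X]big_nat_recr //=.
rewrite subn0 (ar_hor0 _ _ _ _ _ rec) expr0n mulr0 add0r subnn /= expr0n addr0.
rewrite -big_split /=.
apply: (@le_trans _ _ (theta * \sum_(0 <= k < n.+1) (p * h k ^+ 2 + v k ^+ 2))).
  rewrite mulr_sumr; apply: ler_sum_nat => k /andP[_ lekn].
  rewrite subSS subSn // (ar_horS _ _ _ _ _ _ rec) (ar_vertS b).
  exact: contr.
by rewrite exprS mulrCA ler_wpM2l.
Qed.

Lemma ar_coef_decay {R : rcfType} (a b c : R) :
  0 < 1 - a - b - c -> 0 < 1 - a + b + c -> 0 < 1 + a - b + c ->
  0 < 1 + a + b - c ->
  exists C r : R, [/\ 0 < C, 0 < r, r < 1 &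
    forall k l, `|ar_hor b (ar_coef a b c) k l| <= C * r ^+ (k + l) /\
                `|ar_vert (ar_coef a b c) k l| <= C * r ^+ (k + l)].
Proof.
move=> h1 h2 h3 h4.
have [p [th [p0 th0 th1 contr]]] := lyapunov_contraction a b c h1 h2 h3 h4.
have sqb (x y : R) : 0 <= y -> x ^+ 2 <= y ^+ 2 -> `|x| <= y.
  move=> y0 le; rewrite -(@ler_pXn2r _ 2) ?nnegrE //.
  by rewrite real_normK // num_real.
(* The energy bound gives H^2 <= th^(k+l) and V^2 <= p th^(k+l); [1 + p] dominates both 1 and the
   square root of [p]. *)
exists (1 + p), (Num.sqrt th); split.
- by rewrite addr_gt0.
- by rewrite sqrtr_gt0.
- by rewrite -sqrtr1 ltr_sqrt.
move=> k l.
have := ar_energy_decay a b c p th _ (k + l) (ltW th0) contr (ar_coef_recursion a b c).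
rewrite (bigD1_seq k) ?iota_uniq ?mem_index_iota ?ltnS ?leq_addr //= addKn.
set S := \sum_(_ <- _ | _) _; have S0 : 0 <= S.
  by apply: sumr_ge0 => j _; rewrite addr_ge0 ?sqr_ge0 // mulr_ge0 ?sqr_ge0 // ltW.
set h := ar_hor _ _ _ _; set v := ar_vert _ _ _ => le.
have t0 : 0 < th ^+ (k + l) by rewrite exprn_gt0.
have ph0 : 0 <= p * h ^+ 2 by rewrite mulr_ge0 ?sqr_ge0 // ltW.
have v0 := sqr_ge0 v.
have g0 : 0 <= (1 + p) * Num.sqrt th ^+ (k + l).
  by rewrite mulr_ge0 ?exprn_ge0 ?sqrtr_ge0 // addr_ge0 // ltW.
have sq : Num.sqrt th ^+ (k + l) ^+ 2 = th ^+ (k + l).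
  by rewrite exprAC sqr_sqrtr // ltW.
split; apply: sqb => //; rewrite exprMn sq; last by nra.
have : h ^+ 2 <= th ^+ (k + l) by rewrite -(ler_pM2l p0); lra.
by nra.
Qed.

(** * Summability forces the four inequalities *)

(** Turns the value of [1 - a z - b w - c z w] at (z,w) into a value at (1,1) for a rescaled
    recursion. *)
Lemma ar_recursion_scale {R : comNzRingType} (a b c z w : R)
    (psi : nat -> nat -> R) :
  ar_recursion a b c psi ->
  ar_recursion (z * a) (w * b) (z * w * c)
    (fun k l => z ^+ k * w ^+ l * psi k l).
Proof.
case=> p00 p0 p1 p2; split=> [|k|l|k l].
- by rewrite p00 !expr0 !mulr1.
- by rewrite p0 exprS; ring.
- by rewrite p1 exprS; ring.
- by rewrite p2 !exprS; ring.
Qed.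

Definition square_sum {R : nmodType} (u : nat -> nat -> R) (n : nat) : R :=
  \sum_(k < n) \sum_(l < n) u k l.

Lemma square_sumS {R : nmodType} (u : nat -> nat -> R) (n : nat) :
  square_sum u n.+1 =
  square_sum u n + (\sum_(k < n) u k n + \sum_(l < n.+1) u n l).
Proof.
rewrite /square_sum big_ord_recr /= addrA -big_split /=; congr (_ + _).
by apply: eq_bigr => k _; rewrite big_ord_recr.
Qed.

(** Shells are the increments of the square sums; if all were at least [e], the sums would outgrow
    [B]. *)
Lemma small_shell {R : archiRealFieldType} (u : nat -> nat -> R) (B e : R) :
  (forall n, square_sum u n <= B) -> 0 < e ->
  exists n, \sum_(k < n) u k n + \sum_(l < n.+1) u n l < e.
Proof.
move=> leB e0; apply: contrapT => noshell.
have ge n : n%:R * e <= square_sum u n.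
  elim: n => [|n IHn]; first by rewrite mul0r /square_sum big_ord0.
  rewrite square_sumS -natr1 mulrDl mul1r lerD // leNgt.
  by apply/negP => lt; apply: noshell; exists n.
have B0 : 0 <= B / e.
  by rewrite divr_ge0 ?(ltW e0) // (le_trans _ (leB 0%N)) // /square_sum big_ord0.
have := archi_boundP B0; rewrite ltr_pdivrMr // => lt.
by have := lt_le_trans lt (le_trans (ge _) (leB _)); rewrite ltxx.
Qed.

(** If [a + b + c = 1], the constant 1 solves the equation without noise, and the remainder identity
    writes 1 as a combination of [psi] over one shell, where the absolute sum can be made small. *)
Lemma ar_bounded_neq0 {R : realType} (a b c B : R) (psi : nat -> nat -> R) :
  ar_recursion a b c psi ->
  (forall n, square_sum (fun k l => `|psi k l|) n <= B) ->
  1 - a - b - c != 0.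
Proof.
move=> rec leB; apply/eqP => eq0.
(* [K] dominates the boundary weights: 1 + |b| along [psi n l] and |b + c| along [psi k n]. *)
pose K : R := 1 + `|b| + `|b + c|.
have K0 : 0 < K by rewrite /K -addrA ltr_pwDl // addr_ge0.
have [n small] := small_shell _ B K^-1 leB ltac:(by rewrite invr_gt0).
set s := _ + _ in small.
have [r0 c0] : 0 <= \sum_(l < n.+1) `|psi n l| /\ 0 <= \sum_(k < n) `|psi k n|.
  by split; apply: sumr_ge0.
have := ar_remainder a b c psi (fun=> fun=> 1) (fun=> fun=> 0) n n rec.
have ones : forall k l : nat, 1 = a * 1 + b * 1 + c * 1 + 0 :> R.
  by move=> _ _; lra.
move=> /(_ ones) {ones}.
under eq_bigr do under eq_bigr do rewrite mulr0.
rewrite big1 ?subr0; last by move=> k _; rewrite big1.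
under eq_bigr do rewrite mulr1; under [in X in _ + X]eq_bigr do rewrite !mulr1.
move=> one.
suff : 1 <= K * s by rewrite leNgt -(ltr_pdivlMl _ _ K0) mulr1 small.
rewrite -[1]normr1 one.
apply: (le_trans (ler_normD _ _)).
have le1 : `|\sum_(l < n.+1) ar_hor b psi n l| <= (1 + `|b|) * \sum_(l < n.+1) `|psi n l|.
  rewrite /ar_hor sumrB; apply: (le_trans (ler_normB _ _)); rewrite mulrDl mul1r.
  rewrite lerD ?ler_norm_sum // -mulr_sumr normrM ler_wpM2l //.
  rewrite big_ord_recl /= add0r; apply: (le_trans (ler_norm_sum _ _ _)).
  by rewrite [leRHS]big_ord_recr /= lerDl.
have le2 : `|\sum_(k < n) psi k n * (b + c)| <= `|b + c| * \sum_(k < n) `|psi k n|.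
  by rewrite -mulr_suml normrM mulrC ler_wpM2l // ler_norm_sum.
have b0 := normr_ge0 b; have bc0 := normr_ge0 (b + c).
apply: (le_trans (lerD le1 le2)); rewrite /s /K.
rewrite [leRHS]mulrDr addrC lerD // ler_wpM2r //; lra.
Qed.

(** Along [z = w = t] the polynomial starts at 1 for [t = 0]. A zero with [t] in [0,1] would
    contradict the nonvanishing, since scaling by powers of [t] keeps the bound [B]. *)
Lemma ar_bounded_gt0 {R : realType} (a b c B : R) (psi : nat -> nat -> R) :
  ar_recursion a b c psi ->
  (forall n, square_sum (fun k l => `|psi k l|) n <= B) ->
  0 < 1 - a - b - c.
Proof.
move=> rec leB; rewrite ltNge; apply/negP => le0.
pose p := Poly [:: -1; a + b; c].
have pE t : p.[t] = - (1 - t * a - t * b - t * t * c).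
  by rewrite /p horner_Poly /=; ring.
have [||t /andP[t0 t1] /rootP] := @poly_ivt R p 0 1.
- exact: ler01.
- by rewrite !pE; apply/andP; split; rewrite ?mulr0 ?mul0r ?mul1r; lra.
rewrite pE => /eqP; rewrite oppr_eq0; apply/negP.
apply: (ar_bounded_neq0 _ _ _ B _ (ar_recursion_scale a b c t t psi rec)) => n.
apply: le_trans (leB n); apply: ler_sum => k _; apply: ler_sum => l _.
rewrite -exprD normrM ler_piMl // normrX ger0_norm //.
exact: exprn_ile1.
Qed.

(** Scaling by signs leaves |psi(k,l)| unchanged and moves (1,1) to each of the four corners. *)
Lemma ar_bounded_inequalities {R : realType} (a b c B : R)
    (psi : nat -> nat -> R) :
  ar_recursion a b c psi ->
  (forall n, square_sum (fun k l => `|psi k l|) n <= B) ->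
  [/\ 0 < 1 - a - b - c, 0 < 1 - a + b + c,
      0 < 1 + a - b + c & 0 < 1 + a + b - c].
Proof.
move=> rec leB.
have gt0 (i j : bool) : 0 < 1 - (-1) ^+ i * a - (-1) ^+ j * b - (-1) ^+ i * (-1) ^+ j * c.
  have := ar_recursion_scale a b c ((-1) ^+ i) ((-1) ^+ j) psi rec.
  move/ar_bounded_gt0; apply=> n.
  apply: le_trans (leB n); apply: ler_sum => k _; apply: ler_sum => l _.
  by rewrite -!exprM !normrM !normrX !normrN1 !expr1n !mul1r.
split.
- by have := gt0 false false; rewrite !expr0 !mul1r.
- by have := gt0 false true; rewrite expr0 expr1; lra.
- by have := gt0 true false; rewrite expr0 expr1; lra.
- by have := gt0 true true; rewrite expr1; lra.
Qed.

(** * Pathwise bound of the remainder *)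

(** With [q] the square root of [r], the decay r^(k+l) splits into two factors q^(k+l): one brings
    [x k l] below [s], the other sums geometrically along the far sides. *)
Lemma ar_remainder_bound {R : rcfType} (a b c C r s : R)
    (psi x e : nat -> nat -> R) (m n : nat) :
  0 < C -> 0 < r -> r < 1 -> 0 <= s ->
  ar_recursion a b c psi ->
  (forall k l, x k l = a * x k.+1 l + b * x k l.+1 + c * x k.+1 l.+1 + e k l) ->
  (forall k l, `|ar_hor b psi k l| <= C * r ^+ (k + l) /\
               `|ar_vert psi k l| <= C * r ^+ (k + l)) ->
  (forall k l, r ^+ (k + l) * x k l ^+ 2 <= s ^+ 2) ->
  `|x 0%N 0%N - \sum_(k < m) \sum_(l < n) psi k l * e k l| <=
  (C * (1 + `|b| + `|c| / Num.sqrt r) / (1 - Num.sqrt r) + 1) * s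
    * (Num.sqrt r ^+ m + Num.sqrt r ^+ n).
Proof.
move=> C0 r0 r1 s0 rec eqx decay bnd.
set q := Num.sqrt r.
have q0 : 0 < q by rewrite sqrtr_gt0.
have q1 : q < 1 by rewrite -sqrtr1 ltr_sqrt.
have rE : r = q ^+ 2 by rewrite sqr_sqrtr // ltW.
have q1' : 0 < 1 - q by rewrite subr_gt0.
have xb k l : q ^+ (k + l) * `|x k l| <= s.
  rewrite -(@ler_pXn2r _ 2) ?nnegrE ?mulr_ge0 ?exprn_ge0 ?(ltW q0) //.
  by rewrite exprMn real_normK ?num_real // exprAC -rE.
have geo j : \sum_(i < j) q ^+ i <= (1 - q)^-1.
  rewrite -(ler_pM2l q1') mulfV ?gt_eqF //.
  by rewrite -[1 - q]opprB mulNr -subrX1 opprB gerBl exprn_ge0 // ltW.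
have sC : 0 <= s * C by rewrite mulr_ge0 // ltW.
have hb k l : `|ar_hor b psi k l * x k l| <= C * s * q ^+ (k + l).
  rewrite normrM (le_trans (ler_wpM2r _ (decay k l).1)) //.
  rewrite rE exprAC expr2 -!mulrA ler_wpM2l ?(ltW C0) // mulrCA mulrC.
  by rewrite ler_wpM2r ?exprn_ge0 ?(ltW q0).
(* Used with [j] equal to 0 and 1: the far side involves [x k] and [x k.+1], and the shift costs a
   factor [1 / q]. *)
have vb k l j : `|ar_vert psi k l * x (j + k)%N l| <= C * s * q ^+ (k + l) / q ^+ j.
  rewrite normrM (le_trans (ler_wpM2r _ (decay k l).2)) //.
  rewrite ler_pdivlMr ?exprn_gt0 // rE exprAC expr2.
  have := xb (j + k)%N l; rewrite -addnA exprD => le.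
  have Cq : 0 <= C * q ^+ (k + l) by rewrite mulr_ge0 ?exprn_ge0 ?(ltW q0) ?(ltW C0).
  by have := ler_wpM2l Cq le; congr (_ <= _); ring.
set A := C * _ / _; have A0 : 0 <= A.
  rewrite /A !mulr_ge0 ?invr_ge0 ?(ltW C0) ?(ltW q1') //.
  by rewrite !addr_ge0 // divr_ge0 // ltW.
have [qm qn] : 0 <= q ^+ m /\ 0 <= q ^+ n by rewrite !exprn_ge0 // ltW.
case: n => [|n] in qn *.
  (* For [n = 0] the remainder is [x 0 0] itself, at most [s]; the [+ 1] in the constant covers
     it. *)
  under eq_bigr do rewrite big_ord0.
  rewrite big1 // subr0; have := xb 0%N 0%N; rewrite expr0 mul1r => /le_trans -> //.
  apply: (@le_trans _ _ ((A + 1) * s * 1)).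
    by rewrite mulr1 mulrDl mul1r lerDr mulr_ge0.
  by rewrite ler_wpM2l ?mulr_ge0 ?addr_ge0 // lerDr.
rewrite (ar_remainder a b c) //.
apply: (@le_trans _ _ (A * s * (q ^+ m + q ^+ n.+1))); last first.
  by rewrite ler_wpM2r ?addr_ge0 // mulrDl mul1r lerDl.
have -> : A * s * (q ^+ m + q ^+ n.+1) =
    C * s * q ^+ m * (1 + `|b| + `|c| / q) / (1 - q) +
    C * s * q ^+ n.+1 * (1 + `|b| + `|c| / q) / (1 - q) by rewrite /A; ring.
apply: (le_trans (ler_normD _ _)); apply: lerD.
  apply: (le_trans (ler_norm_sum _ _ _)).
  apply: (@le_trans _ _ (C * s * q ^+ m * \sum_(l < n.+1) q ^+ l)).
    by rewrite mulr_sumr; apply: ler_sum => l _; rewrite -mulrA -exprD.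
  have g0 : 0 <= C * s * q ^+ m by rewrite !mulr_ge0 // ltW.
  rewrite ler_pM //; first by apply: sumr_ge0 => l _; rewrite exprn_ge0 // ltW.
    by rewrite ler_peMr // -addrA lerDl addr_ge0 // divr_ge0 // ltW.
apply: (le_trans (ler_norm_sum _ _ _)).
apply: (@le_trans _ _ (C * s * q ^+ n.+1 * (`|b| + `|c| / q) * \sum_(k < m) q ^+ k)).
  rewrite mulr_sumr; apply: ler_sum => k _; rewrite mulrDr.
  apply: (le_trans (ler_normD _ _)).
  have b1 := vb k n.+1 0%N; have b2 := vb k n.+1 1%N.
  rewrite add0n expr0 divr1 in b1; rewrite add1n expr1 in b2.
  have := lerD (ler_wpM2l (normr_ge0 b) b1) (ler_wpM2l (normr_ge0 c) b2).
  rewrite -!normrM exprD; congr (_ + _ <= _); [congr `|_|; ring|congr `|_|; ring|ring].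
have g0 : 0 <= C * s * q ^+ n.+1 by rewrite !mulr_ge0 // ltW.
have g1 : 0 <= `|b| + `|c| / q by rewrite addr_ge0 // divr_ge0 // ltW.
apply: ler_pM => //; first exact: mulr_ge0.
  by apply: sumr_ge0 => l _; rewrite exprn_ge0 // ltW.
by rewrite ler_wpM2l // -addrA lerDr.
Qed.

(** * Geometric and absolutely summable double series *)

Lemma nneseries_geometric_le {R : realType} (C r : R) :
  0 <= C -> 0 < r -> r < 1 ->
  (\sum_(0 <= k <oo) (C * r ^+ k)%:E <= (C / (1 - r))%:E)%E.
Proof.
move=> C0 r0 r1; apply: lime_le.
  by apply: is_cvg_nneseries => k _ _; rewrite lee_fin mulr_ge0 ?exprn_ge0 ?(ltW r0).
apply: nearW => n; rewrite sumEFin lee_fin.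
have := @geometric_le_lim R n C r C0 r0.
by rewrite ger0_norm ?(ltW r0) // => /(_ r1); rewrite /series /=.
Qed.

Lemma nneseries_geometric2_lty {R : realType} (C r : R) :
  0 <= C -> 0 < r -> r < 1 ->
  (\sum_(0 <= k <oo) \sum_(0 <= l <oo) (C * r ^+ (k + l))%:E < +oo)%E.
Proof.
move=> C0 r0 r1.
have D0 : 0 <= C / (1 - r) by rewrite divr_ge0 // subr_ge0 (ltW r1).
apply: le_lt_trans (ltry (C / (1 - r) / (1 - r))).
apply: le_trans (nneseries_geometric_le _ _ D0 r0 r1).
apply: lee_nneseries => [k _ _|k _].
  by apply: nneseries_ge0 => l _ _; rewrite lee_fin mulr_ge0 ?exprn_ge0 ?(ltW r0).
have Ck : 0 <= C * r ^+ k by rewrite mulr_ge0 ?exprn_ge0 ?(ltW r0).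
rewrite mulrAC; apply: le_trans (nneseries_geometric_le _ _ Ck r0 r1).
apply: lee_nneseries => [l _ _|l _]; last by rewrite -mulrA -exprD.
by rewrite lee_fin mulr_ge0 ?exprn_ge0 ?(ltW r0).
Qed.

Lemma absolutely_summable_bounded {R : realType} (psi : nat -> nat -> R) :
  absolutely_summable psi ->
  exists B, forall n, square_sum (fun k l => `|psi k l|) n <= B.
Proof.
rewrite /absolutely_summable; set S := (\sum_(_ <= _ <oo) _)%E => Soo.
have in0 k : (0 <= \sum_(0 <= l <oo) `|psi k l|%:E)%E.
  by apply: nneseries_ge0 => l _ _; rewrite lee_fin.
have S0 : (0 <= S)%E by apply: nneseries_ge0 => k _ _; exact: in0.
exists (fine S) => n; rewrite -lee_fin fineK ?ge0_fin_numE //.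
apply: le_trans (nneseries_lim_ge n _); last by move=> k _ _; exact: in0.
rewrite /square_sum -sumEFin big_mkord; apply: lee_sum => k _.
rewrite -sumEFin -(big_mkord xpredT (fun l => `|psi k l|%:E)).
by apply: nneseries_lim_ge => l _ _; rewrite lee_fin.
Qed.

Lemma absolutely_summable_geometric {R : realType} (psi : nat -> nat -> R)
    (C r : R) : 0 < C -> 0 < r -> r < 1 ->
  (forall k l, `|psi k l| <= C * r ^+ (k + l)) -> absolutely_summable psi.
Proof.
move=> C0 r0 r1 le; apply: le_lt_trans (nneseries_geometric2_lty _ _ (ltW C0) r0 r1).
apply: lee_nneseries => [k _ _|k _].
  by apply: nneseries_ge0 => l _ _; rewrite lee_fin.
apply: lee_nneseries => [l _ _|l _]; first by rewrite lee_fin.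
by rewrite lee_fin.
Qed.

Lemma cvg_geometric_pair {R : realType} (q : R) : 0 < q -> q < 1 ->
  (q ^+ mn.1 + q ^+ mn.2) @[mn --> (\oo, \oo)] --> (0 : R).
Proof.
move=> q0 q1; rewrite -[0]addr0.
have cq : q ^+ n @[n --> \oo] --> (0 : R) by apply: cvg_expr; rewrite ger0_norm // ltW.
apply: cvgD.
  exact: (cvg_comp _ _ cvg_fst cq).
exact: (cvg_comp _ _ cvg_snd cq).
Qed.

(** * Second moments and an integrable dominating series *)

Lemma ge0_expectationZl {d : measure_display} {T : measurableType d}
    {R : realType} (P : probability T R) (k : R) (f : T -> R) :
  0 <= k -> measurable_fun setT f -> (forall w, 0 <= f w) ->
  ('E_P[fun w => (k * f w)%R] = k%:E * 'E_P[f])%E.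
Proof.
move=> k0 mf f0; rewrite unlock.
under eq_integral do rewrite EFinM.
rewrite ge0_integralZl //; first exact/measurable_EFinP.
by move=> w _; rewrite lee_fin.
Qed.

Lemma ge0_expectationD {d : measure_display} {T : measurableType d}
    {R : realType} (P : probability T R) (f g : T -> R) :
  measurable_fun setT f -> measurable_fun setT g ->
  (forall w, 0 <= f w) -> (forall w, 0 <= g w) ->
  ('E_P[fun w => (f w + g w)%R] = 'E_P[f] + 'E_P[g])%E.
Proof.
move=> mf mg f0 g0; rewrite unlock.
under eq_integral do rewrite EFinD.
by rewrite ge0_integralD //; try exact/measurable_EFinP; move=> w _; rewrite lee_fin.
Qed.

Lemma ge0_expectation_cst {d : measure_display} {T : measurableType d}
    {R : realType} (P : probability T R) (k : R) :
  ('E_P[fun=> k] = k%:E)%E.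
Proof. exact: expectation_cst. Qed.

(** Mean [mu] and variance are the same at all sites, and E X^2 <= 2 Var X + 2 mu^2. *)
Lemma stationary_second_moment_bounded {d : measure_display}
    {T : measurableType d} {R : realType} {P : probability T R}
    (X : int -> int -> {RV P >-> R}) :
  wide_sense_stationary X ->
  exists K : R, 0 <= K /\
    forall i j, ('E_P[fun w => (X i j w ^+ 2)%R] <= K%:E)%E.
Proof.
move=> [X2 mX cX]; pose mu := fine ('E_P[X 0%R 0%R])%E.
have mXi i j : measurable_fun setT (X i j) by [].
have covE i j : covariance P (X i j) (X i j) = ('E_P[fun w => ((X i j w - mu) ^+ 2)%R])%E.
  by rewrite unlock (mX i j 0 0).
have cov0 i j : covariance P (X i j) (X i j) = covariance P (X 0 0) (X 0 0).
  by have := cX 0 0 i j 0 0; rewrite !subr0.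
(* Used with [f = X - mu] to see that the variance is finite, then with [f = X] to bound the second
   moments. *)
have bound (f g : T -> R) : measurable_fun setT f -> measurable_fun setT g ->
    (forall w, f w = g w + mu \/ f w = g w - mu) ->
    ('E_P[fun w => (f w ^+ 2)%R] <=
     2%:E * 'E_P[fun w => (g w ^+ 2)%R] + (2 * mu ^+ 2)%:E)%E.
  move=> mf mg fg.
  have mg2 : measurable_fun setT (fun w => 2 * g w ^+ 2).
    by apply: measurable_funM => //; exact: measurable_funX.
  rewrite -(ge0_expectationZl P) ?ler0n //; last 2 first.
  - exact: measurable_funX.
  - by move=> w; rewrite sqr_ge0.
  rewrite -(ge0_expectation_cst P (2 * mu ^+ 2)) -ge0_expectationD //; last 2 first.
  - by move=> w; rewrite mulr_ge0 ?sqr_ge0.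
  - by move=> w; rewrite mulr_ge0 ?sqr_ge0.
  apply: expectation_le.
  - exact: measurable_funX.
  - exact: (measurable_funD mg2 (measurable_cst _)).
  - by move=> w; rewrite sqr_ge0.
  - by move=> w; rewrite addr_ge0 // mulr_ge0 ?sqr_ge0.
  apply: aeW => w.
  have h1 := sqr_ge0 (g w - mu); have h2 := sqr_ge0 (g w + mu).
  by case: (fg w) => ->; nra.
pose c0 := covariance P (X 0 0) (X 0 0).
have c0fin : (c0 < +oo)%E.
  rewrite /c0 covE; apply: (le_lt_trans (bound _ (X 0 0) _ _ _)).
  - by apply: measurable_funB.
  - by [].
  - by move=> w; right.
  by rewrite lte_add_pinfty ?ltry // lte_mul_pinfty // lee_fin ler0n.
have c00 : (0 <= c0)%E by exact: variance_ge0.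
exists (2 * fine c0 + 2 * mu ^+ 2); split.
  by rewrite addr_ge0 // mulr_ge0 ?sqr_ge0 ?fine_ge0.
move=> i j; rewrite EFinD EFinM fineK ?ge0_fin_numE // /c0 -(cov0 i j) covE.
apply: bound => //; first exact: measurable_funB.
by move=> w; left; rewrite subrK.
Qed.

(** [Z] is the whole weighted double series; exchanging sums and integral bounds its mean by a
    geometric series with factor [K]. *)
Lemma weighted_square_dominated {d : measure_display} {T : measurableType d}
    {R : realType} (P : probability T R) (x : nat -> nat -> T -> R) (K r : R) :
  0 <= K -> 0 < r -> r < 1 ->
  (forall k l, measurable_fun setT (x k l)) ->
  (forall k l, ('E_P[fun w => (x k l w ^+ 2)%R] <= K%:E)%E) ->
  exists Z : T -> \bar R, [/\ measurable_fun setT Z, forall w, (0 <= Z w)%E,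
    (\int[P]_w Z w < +oo)%E &
    forall k l w, ((r ^+ (k + l) * x k l w ^+ 2)%:E <= Z w)%E].
Proof.
move=> K0 r0 r1 mx EK.
pose f k l w : \bar R := (r ^+ (k + l) * x k l w ^+ 2)%:E.
have f0 k l w : (0 <= f k l w)%E.
  by rewrite lee_fin mulr_ge0 ?sqr_ge0 ?exprn_ge0 ?(ltW r0).
have mf k l : measurable_fun setT (f k l).
  apply/measurable_EFinP; apply: measurable_funM => //.
  exact: measurable_funX.
pose g k w := (\sum_(0 <= l <oo) f k l w)%E.
have g0 k w : (0 <= g k w)%E by apply: nneseries_ge0.
have mg k : measurable_fun setT (g k) by apply: ge0_emeasurable_sum.
exists (fun w => \sum_(0 <= k <oo) g k w)%E; split.
- by apply: ge0_emeasurable_sum.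
- by move=> w; apply: nneseries_ge0.
- rewrite integral_nneseries //.
  apply: le_lt_trans (nneseries_geometric2_lty _ _ K0 r0 r1).
  apply: lee_nneseries => [k _ _|k _]; first exact: integral_ge0.
  rewrite integral_nneseries //.
  apply: lee_nneseries => [l _ _|l _]; first exact: integral_ge0.
  have mx2 : measurable_fun setT (fun w => x k l w ^+ 2) by exact: measurable_funX.
  have rk : 0 <= r ^+ (k + l) by rewrite exprn_ge0 ?(ltW r0).
  have := ge0_expectationZl P _ _ rk mx2 (fun w => sqr_ge0 _).
  have := EK k l; rewrite unlock /f => le ->.
  by rewrite mulrC EFinM; apply: lee_wpmul2l.
- move=> k l w.
  have term (u : nat -> \bar R) n : (forall m, (0 <= u m)%E) ->
      (u n <= \sum_(0 <= m <oo) u m)%E.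
    move=> u0; apply: le_trans (nneseries_lim_ge n.+1 _); last by move=> m _ _.
    by rewrite big_nat_recr //= leeDr // sume_ge0.
  by apply: (@le_trans _ _ (g k w)); [exact: (term (f k ^~ w))|exact: (term (g ^~ w))].
Qed.

(** * Causality from the inequalities *)

Lemma measurable_ma_partial_sum {d : measure_display} {T : measurableType d}
    {R : realType} {P : probability T R} (eps : int -> int -> {RV P >-> R})
    (psi : nat -> nat -> R) (i j : int) (m n : nat) :
  measurable_fun setT (ma_partial_sum eps psi i j m n).
Proof.
apply: measurable_sum => k; apply: measurable_sum => l.
exact: measurable_funM.
Qed.

(** One random factor, the root of [Z], times [q^m + q^n] bounds every truncation error. [Z] is
    almost surely finite, which gives pathwise convergence, and integrable, which gives mean square
    convergence. *)
Lemma causal_of_inequalities {d : measure_display} {T : measurableType d}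
    {R : realType} {P : probability T R} (a b c : R)
    (eps X : int -> int -> {RV P >-> R}) :
  wide_sense_stationary X ->
  (forall i j : int, {ae P, forall w,
      X i j w = a * X (i - 1) j w + b * X i (j - 1) w
                + c * X (i - 1) (j - 1) w + eps i j w}) ->
  0 < 1 - a - b - c -> 0 < 1 - a + b + c -> 0 < 1 + a - b + c ->
  0 < 1 + a + b - c ->
  causal_representation X eps (ar_coef a b c).
Proof.
move=> statX eqX h1 h2 h3 h4.
have [C [r [C0 r0 r1 decay]]] := ar_coef_decay a b c h1 h2 h3 h4.
have [K [K0 EK]] := stationary_second_moment_bounded X statX.
split.
  apply: (absolutely_summable_geometric _ C r) => // k l.
  (* [psi k l] is [ar_vert] at [l.+1]; the spare factor [r] is dropped. *)
  apply: (le_trans (decay k l.+1).2).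
  by rewrite ler_pM2l // addnS exprS ler_piMl ?exprn_ge0 ?(ltW r0) ?(ltW r1).
move=> i j; pose x k l w := X (i - k%:Z) (j - l%:Z) w.
pose e k l w := eps (i - k%:Z) (j - l%:Z) w.
have shift (i' : int) (k : nat) : i' - k.+1%:Z = i' - k%:Z - 1 by lia.
(* Countably many equations hold outside one null set, so summation by parts works path by path. *)
have eqx : {ae P, forall w k l,
    x k l w = a * x k.+1 l w + b * x k l.+1 w + c * x k.+1 l.+1 w + e k l w}.
  apply/ae_foralln => k; apply/ae_foralln => l.
  have := eqX (i - k%:Z) (j - l%:Z); apply: filterS => w.
  by rewrite /x /e (shift i k) (shift j l).
have mx k l : measurable_fun setT (x k l) by [].
have [Z [mZ Z0 Zoo domZ]] :=
  weighted_square_dominated P x K r K0 r0 r1 mx (fun k l => EK _ _).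
have finZ : {ae P, forall w, Z w \is a fin_num}.
  have intZ : P.-integrable setT Z.
    apply/integrableP; split=> //.
    by under eq_integral do rewrite gee0_abs //.
  by have := integrable_ae measurableT intZ; apply: filterS => w /(_ I).
set q := Num.sqrt r.
have q0 : 0 < q by rewrite sqrtr_gt0.
have q1 : q < 1 by rewrite -sqrtr1 ltr_sqrt.
pose A := C * (1 + `|b| + `|c| / q) / (1 - q) + 1.
have bound : {ae P, forall w, Z w \is a fin_num /\ forall m n,
    `|ma_partial_sum eps (ar_coef a b c) i j m n w - X i j w| <=
    A * Num.sqrt (fine (Z w)) * (q ^+ m + q ^+ n)}.
  apply: filterS2 finZ eqx => w finw eqw; split=> // m n.
  have domw k l : r ^+ (k + l) * x k l w ^+ 2 <= Num.sqrt (fine (Z w)) ^+ 2.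
    by rewrite sqr_sqrtr ?fine_ge0 // -lee_fin fineK.
  have := ar_remainder_bound a b c C r _ _ (fun k l => x k l w)
    (fun k l => e k l w) m n C0 r0 r1 (sqrtr_ge0 (fine (Z w)))
    (ar_coef_recursion a b c) eqw decay domw.
  by rewrite distrC /x !subr0.
have cq := cvg_geometric_pair q q0 q1.
split; last first.
  apply: filterS bound => w [_ bw].
  set B := A * _ in bw.
  have cB : B * (q ^+ mn.1 + q ^+ mn.2) @[mn --> (\oo, \oo)] --> (0 : R).
    by rewrite -[0](mulr0 B); apply: cvgMl_tmp.
  apply/cvgrPdistC_le => /= eta eta0.
  move/cvgr0Pnorm_le: cB => /(_ _ eta0); apply: filterS => mn.
  by apply: le_trans; apply: le_trans (bw _ _) (ler_norm _).
pose z := fine (\int[P]_w Z w).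
have zE : (\int[P]_w Z w = z%:E)%E by rewrite fineK // ge0_fin_numE // integral_ge0.
(* The mean squared error lies between 0 and the squared deterministic factor times the mean of
   [Z]. *)
apply: (@squeeze_cvge _ _ _ _ (fun=> 0%E) _
  (fun mn => ((A * (q ^+ mn.1 + q ^+ mn.2)) ^+ 2 * z)%:E)).
- apply: nearW => -[m n] /=; apply/andP; split.
    by apply: expectation_ge0 => w; exact: sqr_ge0.
  rewrite EFinM -zE -ge0_integralZl //; last by rewrite lee_fin sqr_ge0.
  rewrite unlock; apply: ae_ge0_le_integral => //.
  + by move=> w _; rewrite lee_fin sqr_ge0.
  + apply/measurable_EFinP; apply: measurable_funX; apply: measurable_funB => //.
    exact: measurable_ma_partial_sum.
  + by move=> w _; rewrite mule_ge0 // lee_fin sqr_ge0.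
  + exact: measurable_funeM.
  apply: filterS bound => w [finw bw] _.
  rewrite -(fineK finw) -EFinM lee_fin -(sqr_sqrtr (fine_ge0 (Z0 w))) -exprMn.
  rewrite -real_normK ?num_real // ler_pXn2r ?nnegrE //.
    by rewrite mulrAC; exact: bw.
  by rewrite mulrAC; apply: le_trans (bw m n).
- exact: cvg_cst.
- apply: cvg_EFin; first by apply: nearW.
  have cA : A * (q ^+ mn.1 + q ^+ mn.2) @[mn --> (\oo, \oo)] --> (0 : R).
    by rewrite -[0](mulr0 A); apply: cvgMl_tmp.
  rewrite -[X in _ --> X](mul0r z) -[in X in _ --> X](mulr0 0).
  by apply: cvgMr_tmp; exact: cvgM.
Qed.

(** * Covariances of the partial sums with the noise *)

Lemma Lfun2_second_moment {d : measure_display} {T : measurableType d}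
    {R : realType} (P : probability T R) (f : T -> R) :
  measurable_fun setT f -> ('E_P[fun w => (f w ^+ 2)%R] < +oo)%E ->
  f \in Lfun P 2%:E.
Proof.
move=> mf Ef; rewrite inE; apply/andP; split; rewrite inE //=.
rewrite /finite_norm unlock /Lnorm poweR_lty //.
apply: le_lt_trans Ef; rewrite unlock le_eqVlt; apply/orP; left; apply/eqP.
apply: eq_integral => w _.
by rewrite /= powR_mulrn ?normr_ge0 // real_normK ?num_real.
Qed.

Lemma Lfun2_sum {d : measure_display} {T : measurableType d} {R : realType}
    (P : probability T R) (I : Type) (s : seq I) (u : I -> R)
    (f : I -> T -> R) : (forall i, f i \in Lfun P 2%:E) ->
  (fun w => \sum_(i <- s) u i * f i w) \in Lfun P 2%:E.
Proof.
move=> f2; elim: s => [|i s IHs].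
  under eq_fun do rewrite big_nil; exact: Lfun_cst.
under eq_fun do rewrite big_cons.
have -> : (fun w => u i * f i w + \sum_(j <- s) u j * f j w) =
    (u i \o* f i) \+ (fun w => \sum_(j <- s) u j * f j w).
  by apply/funext => w /=; rewrite mulrC.
by rewrite rpredD ?lee1n //= => p12; rewrite Lfun_scale ?ler1n.
Qed.

Lemma covariance_suml {d : measure_display} {T : measurableType d}
    {R : realType} (P : probability T R) (I : Type) (s : seq I) (u : I -> R)
    (f : I -> T -> R) (g : T -> R) :
  (forall i, f i \in Lfun P 2%:E) -> g \in Lfun P 2%:E ->
  covariance P (fun w => \sum_(i <- s) u i * f i w) g =
  (\sum_(i <- s) (u i)%:E * covariance P (f i) g)%E.
Proof.
move=> f2 g2; have Pfin := fin_num_measure P _ measurableT.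
elim: s => [|i s IHs].
  under eq_fun do rewrite big_nil; rewrite big_nil; exact: covariance_cst_l.
under eq_fun do rewrite big_cons.
have -> : (fun w => u i * f i w + \sum_(j <- s) u j * f j w) =
    (u i \o* f i) \+ (fun w => \sum_(j <- s) u j * f j w).
  by apply/funext => w /=; rewrite mulrC.
rewrite covarianceDl //; [|by rewrite Lfun_scale ?ler1n|exact: Lfun2_sum].
rewrite IHs big_cons covarianceZl //; last exact: Lfun2_mul_Lfun1.
- exact: (Lfun_subset12 Pfin).
- exact: (Lfun_subset12 Pfin).
Qed.

(** Nonnegativity of the variance of [W - D g] gives Var W >= D^2 s, a division-free form of
    Cauchy-Schwarz. *)
Lemma second_moment_ge_covariance {d : measure_display} {T : measurableType d}
    {R : realType} (P : probability T R) (W g : T -> R) (D s : R) :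
  W \in Lfun P 2%:E -> g \in Lfun P 2%:E ->
  covariance P g g = s%:E -> covariance P W g = (D * s)%:E ->
  ((D ^+ 2 * s)%:E <= 'E_P[fun w => (W w ^+ 2)%R])%E.
Proof.
move=> W2 g2 Vg cWg; have Pfin := fin_num_measure P _ measurableT.
have W1 := Lfun_subset12 Pfin W2; have g1 := Lfun_subset12 Pfin g2.
have VW : (variance P W <= 'E_P[fun w => (W w ^+ 2)%R])%E.
  rewrite varianceE // leeBlDr ?fin_numX ?expectation_fin_num //.
  by rewrite leeDl // sqre_ge0.
apply: le_trans VW.
have := variance_ge0 P (W \- (D \o* g)).
rewrite varianceB ?Lfun_scale ?ler1n // varianceZ // covarianceZr ?Lfun2_mul_Lfun1 //.
rewrite {2}/variance Vg cWg -(fineK (variance_fin_num W2)).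
by rewrite -!EFinM !lee_fin; lra.
Qed.

Lemma white_noise_covariance {d : measure_display} {T : measurableType d}
    {R : realType} {P : probability T R} (eps : int -> int -> {RV P >-> R})
    (sigma2 : R) :
  white_noise eps sigma2 ->
  forall i j i' j', covariance P (eps i j) (eps i' j') =
    (((i, j) == (i', j'))%:R * sigma2)%:E.
Proof.
move=> [E0 V0 C0] i j i' j'; case: eqVneq => [[-> ->]|ne]; last by rewrite C0 // mul0r.
rewrite mul1r -(V0 i' j') unlock E0 /=; congr expectation; apply/funext => w.
by rewrite !fctE /= subr0.
Qed.

Lemma white_noise_Lfun2 {d : measure_display} {T : measurableType d}
    {R : realType} {P : probability T R} (eps : int -> int -> {RV P >-> R})
    (sigma2 : R) :
  white_noise eps sigma2 -> forall i j, (eps i j : T -> R) \in Lfun P 2%:E.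
Proof.
by move=> [_ V0 _] i j; apply: Lfun2_second_moment => //; rewrite V0 ltry.
Qed.

Lemma ma_partial_sum_pairE {d : measure_display} {T : measurableType d}
    {R : realType} {P : probability T R} (eps : int -> int -> {RV P >-> R})
    (psi : nat -> nat -> R) (i j : int) (m n : nat) :
  ma_partial_sum eps psi i j m n =
  (fun w => \sum_(p : 'I_m * 'I_n)
     psi p.1 p.2 * eps (i - (p.1 : nat)%:Z) (j - (p.2 : nat)%:Z) w).
Proof. by apply/funext => w; rewrite /ma_partial_sum pair_bigA. Qed.

Lemma Lfun2_ma_partial_sum {d : measure_display} {T : measurableType d}
    {R : realType} {P : probability T R} (eps : int -> int -> {RV P >-> R})
    (sigma2 : R) (psi : nat -> nat -> R) (i j : int) (m n : nat) :
  white_noise eps sigma2 -> ma_partial_sum eps psi i j m n \in Lfun P 2%:E.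
Proof.
move=> wn; rewrite ma_partial_sum_pairE; apply: Lfun2_sum => p.
exact: white_noise_Lfun2 wn _ _.
Qed.

Lemma covariance_ma_partial_sum {d : measure_display} {T : measurableType d}
    {R : realType} {P : probability T R} (eps : int -> int -> {RV P >-> R})
    (sigma2 : R) (psi : nat -> nat -> R) (i j : int) (m n k l : nat) :
  white_noise eps sigma2 -> (k < m)%N -> (l < n)%N ->
  covariance P (ma_partial_sum eps psi i j m n) (eps (i - k%:Z) (j - l%:Z)) =
  (psi k l * sigma2)%:E.
Proof.
move=> wn km ln; have eps2 := white_noise_Lfun2 _ _ wn.
rewrite ma_partial_sum_pairE covariance_suml //.
under eq_bigr do rewrite (white_noise_covariance _ _ wn) -EFinM.
rewrite sumEFin (bigD1 (Ordinal km, Ordinal ln)) //= eqxx mul1r.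
rewrite big1 ?addr0 // => -[k' l'] /= ne; case: eqP => [[ek el]|];
  last by rewrite mul0r mulr0.
case/negP: ne; rewrite xpair_eqE -!val_eqE /=.
by apply/andP; split; apply/eqP; lia.
Qed.

(** A partial sum involves noise only at sites no later in either coordinate. These zeros act as
    [psi] at negative indices in the recursion. *)
Lemma covariance_ma_partial_sum_future {d : measure_display}
    {T : measurableType d} {R : realType} {P : probability T R}
    (eps : int -> int -> {RV P >-> R}) (sigma2 : R) (psi : nat -> nat -> R)
    (i j i' j' : int) (m n : nat) :
  white_noise eps sigma2 -> (i < i') || (j < j') ->
  covariance P (ma_partial_sum eps psi i j m n) (eps i' j') = 0%:E.
Proof.
move=> wn lt; have eps2 := white_noise_Lfun2 _ _ wn.
rewrite ma_partial_sum_pairE covariance_suml //.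
under eq_bigr do rewrite (white_noise_covariance _ _ wn) -EFinM.
rewrite sumEFin big1 // => -[k' l'] /= _; case: eqP => [[ek el]|];
  last by rewrite mul0r mulr0.
by exfalso; move: lt; lia.
Qed.

(** * Recursion from a causal representation *)

Lemma ge0_expectation_le_lin {d : measure_display} {T : measurableType d}
    {R : realType} (P : probability T R) (f g : T -> R) (k x y : R) :
  0 <= k -> measurable_fun setT f -> measurable_fun setT g ->
  (forall w, 0 <= f w) -> (forall w, 0 <= g w) ->
  ('E_P[f] <= x%:E)%E -> ('E_P[g] <= y%:E)%E ->
  ('E_P[fun w => (f w + k * g w)%R] <= (x + k * y)%:E)%E.
Proof.
move=> k0 mf mg f0 g0 Ef Eg.
have mkg : measurable_fun setT (fun w => k * g w) by exact: measurable_funM.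
rewrite ge0_expectationD //; last by move=> w; rewrite mulr_ge0.
by rewrite ge0_expectationZl // EFinD EFinM leeD // lee_wpmul2l.
Qed.

(** The gap is a sum of squares over pairs. The leading 0 matches the zero function from which the
    expectation bound is built term by term. *)
Lemma sqr_sub4_le {R : realDomainType} (p q r s : R) :
  (p - q - r - s) ^+ 2 <= 0 + 4 * p ^+ 2 + 4 * q ^+ 2 + 4 * r ^+ 2 + 4 * s ^+ 2.
Proof.
rewrite -subr_ge0.
have -> : 0 + 4 * p ^+ 2 + 4 * q ^+ 2 + 4 * r ^+ 2 + 4 * s ^+ 2 - (p - q - r - s) ^+ 2
  = (p + q) ^+ 2 + (p + r) ^+ 2 + (p + s) ^+ 2 + (q - r) ^+ 2 + (q - s) ^+ 2
    + (r - s) ^+ 2 by ring.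
by rewrite !addr_ge0 ?sqr_ge0.
Qed.

(** Replacing [X] by partial sums in the equation leaves a defect [W] of arbitrarily small second
    moment, yet its covariance with one noise variable is [D * sigma2]. With the covariances as a
    hypothesis, all clauses of the recursion share this limit argument. *)
Lemma causal_innovation_eq0 {d : measure_display} {T : measurableType d}
    {R : realType} {P : probability T R} (a b c sigma2 : R)
    (eps X : int -> int -> {RV P >-> R}) (psi : nat -> nat -> R) (D : R)
    (k l : nat) :
  0 < sigma2 -> white_noise eps sigma2 ->
  {ae P, forall w, X 0 0 w = a * X (0 - 1) 0 w + b * X 0 (0 - 1) w
                + c * X (0 - 1) (0 - 1) w + eps 0 0 w} ->
  causal_representation X eps psi ->
  (forall m n, (k < m)%N -> (l < n)%N ->
    let S i j := ma_partial_sum eps psi i j m n in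
    let cov f := covariance P f (eps (0 - k%:Z) (0 - l%:Z)) in
    exists x0 x1 x2 x3 x4 : R, [/\
      cov (S 0 0) = (x0 * sigma2)%:E, cov (S (0 - 1) 0) = (x1 * sigma2)%:E,
      cov (S 0 (0 - 1)) = (x2 * sigma2)%:E,
      cov (S (0 - 1) (0 - 1)) = (x3 * sigma2)%:E &
      cov (eps 0 0) = (x4 * sigma2)%:E /\
      D = x0 - a * x1 - b * x2 - c * x3 - x4]) ->
  D = 0.
Proof.
move=> s0 wn eqX [_ repr] covs; apply/eqP/negPn/negP => D0.
(* The four-term inequality will give E W^2 <= B eta, and [eta] makes [B eta] half of the lower
   bound [D^2 sigma2]. *)
pose B := 4 * (1 + a ^+ 2 + b ^+ 2 + c ^+ 2).
have B0 : 0 < B.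
  by rewrite /B; have := sqr_ge0 a; have := sqr_ge0 b; have := sqr_ge0 c; lra.
pose eta := D ^+ 2 * sigma2 / (2 * B).
have Ds : 0 < D ^+ 2 * sigma2 by rewrite mulr_gt0 // exprn_even_gt0.
have eta0 : 0 < eta by rewrite divr_gt0 // mulr_gt0.
have small i j : exists N, forall m n, (N <= m)%N -> (N <= n)%N ->
    ('E_P[fun w => ((ma_partial_sum eps psi i j m n w - X i j w) ^+ 2)%R] <= eta%:E)%E.
  have [/fine_cvgP[finu /cvgr0Pnorm_le/(_ _ eta0) leu] _] := repr i j.
  have [[U V] [[N1 _ UN] [N2 _ VN]] sub] := filterI finu leu.
  exists (maxn N1 N2) => m n; rewrite !geq_max => /andP[m1 m2] /andP[n1 n2].
  have [fin le] := sub (m, n) (conj (UN m m1) (VN n n2)).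
  by rewrite -(fineK fin) lee_fin; apply: le_trans (ler_norm _) le.
have [N0 s00] := small 0 0; have [N1 s10] := small (0 - 1) 0.
have [N2 s01] := small 0 (0 - 1); have [N3 s11] := small (0 - 1) (0 - 1).
pose N := (k + l + N0 + N1 + N2 + N3).+1.
pose S i j := ma_partial_sum eps psi i j N N.
pose W := S 0 0 \- a \o* S (0 - 1) 0 \- b \o* S 0 (0 - 1)
          \- c \o* S (0 - 1) (0 - 1) \- eps 0 0.
have Pfin := fin_num_measure P _ measurableT.
have S2 i j : S i j \in Lfun P 2%:E by exact: Lfun2_ma_partial_sum wn.
have Z2 u i j : u \o* S i j \in Lfun P 2%:E by rewrite Lfun_scale ?ler1n.
have e2 := white_noise_Lfun2 _ _ wn.
have BL (f g : T -> R) : f \in Lfun P 2%:E -> g \in Lfun P 2%:E -> f \- g \in Lfun P 2%:E.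
  by move=> f2 g2; rewrite rpredB ?lee1n.
have covW : covariance P W (eps (0 - k%:Z) (0 - l%:Z)) = (D * sigma2)%:E.
  have kN : (k < N)%N by rewrite /N; lia.
  have lN : (l < N)%N by rewrite /N; lia.
  have [x0 [x1 [x2 [x3 [x4 [c0 c1 c2 c3 [c4 ->]]]]]]] := covs N N kN lN.
  have covZ u i j : covariance P (u \o* S i j) (eps (0 - k%:Z) (0 - l%:Z)) =
      (u%:E * covariance P (S i j) (eps (0 - k%:Z)%R (0 - l%:Z)%R))%E.
    by rewrite covarianceZl ?Lfun2_mul_Lfun1 // (Lfun_subset12 Pfin).
  rewrite /W !covarianceBl ?BL // !covZ c0 c1 c2 c3 c4 -!EFinM -!EFinB.
  by congr (_%:E); ring.
have W2 : W \in Lfun P 2%:E by rewrite /W !BL.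
have ee : covariance P (eps (0 - k%:Z) (0 - l%:Z)) (eps (0 - k%:Z) (0 - l%:Z)) =
    sigma2%:E.
  by rewrite (white_noise_covariance _ _ wn) eqxx mul1r.
have := second_moment_ge_covariance P W _ D sigma2 W2 (e2 _ _) ee covW.
apply/negP; rewrite -ltNge.
pose Q i j w := (S i j w - X i j w) ^+ 2.
have Q0 i j w : 0 <= Q i j w by exact: sqr_ge0.
have mS i j : measurable_fun setT (S i j) by exact: measurable_ma_partial_sum.
have mQ i j : measurable_fun setT (Q i j).
  by apply: measurable_funX; exact: measurable_funB.
have m0 : measurable_fun setT (fun _ : T => 0 : R) by [].
have add (f : T -> R) (u : R) i j : 0 <= u -> measurable_fun setT f ->
    (forall w, 0 <= f w) ->
    measurable_fun setT (fun w => f w + u * Q i j w) /\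
    (forall w, 0 <= f w + u * Q i j w).
  move=> u0 mf f0; split=> [|w]; last by rewrite addr_ge0 // mulr_ge0.
  by apply: measurable_funD => //; exact: measurable_funM.
have four : 0 <= 4 :> R by [].
have sq4 (u : R) : 0 <= 4 * u ^+ 2 by rewrite mulr_ge0 // sqr_ge0.
have [m1 p1] := add _ _ 0 0 four m0 (fun=> lexx 0).
have [m2 p2] := add _ _ (0 - 1) 0 (sq4 a) m1 p1.
have [m3 p3] := add _ _ 0 (0 - 1) (sq4 b) m2 p2.
have [m4 p4] := add _ _ (0 - 1) (0 - 1) (sq4 c) m3 p3.
have EQ : ('E_P[fun w => (0 + 4 * Q 0%R 0%R w + (4 * a ^+ 2) * Q (0 - 1)%R 0%R w
   + (4 * b ^+ 2) * Q 0%R (0 - 1)%R w + (4 * c ^+ 2) * Q (0 - 1)%R (0 - 1)%R w)%R]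
   <= (0 + 4 * eta + 4 * a ^+ 2 * eta + 4 * b ^+ 2 * eta + 4 * c ^+ 2 * eta)%:E)%E.
  apply: ge0_expectation_le_lin => //; last by apply: s11; rewrite /N; lia.
  apply: ge0_expectation_le_lin => //; last by apply: s01; rewrite /N; lia.
  apply: ge0_expectation_le_lin => //; last by apply: s10; rewrite /N; lia.
  apply: ge0_expectation_le_lin => //; last by apply: s00; rewrite /N; lia.
  by rewrite expectation_cst.
apply: (@le_lt_trans _ _ (B * eta)%:E); last first.
  rewrite lte_fin /eta; have -> : B * (D ^+ 2 * sigma2 / (2 * B)) = D ^+ 2 * sigma2 / 2.
    by field; rewrite gt_eqF.
  lra.
have -> : B * eta = 0 + 4 * eta + 4 * a ^+ 2 * eta + 4 * b ^+ 2 * eta + 4 * c ^+ 2 * eta.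
  by rewrite /B; ring.
apply: le_trans EQ; apply: expectation_le.
- by apply: measurable_funX; move: W2; rewrite inE => /andP[]; rewrite inE.
- exact: m4.
- by move=> w; exact: sqr_ge0.
- exact: p4.
(* The equation cancels the noise, so [W] is a combination of the four truncation errors. *)
apply: filterS eqX => w eqw; rewrite /W /Q /= eqw.
set d1 := S (0 - 1) 0 w; set d2 := S 0 (0 - 1) w.
set d3 := S (0 - 1) (0 - 1) w; set d0 := S 0 0 w.
have := sqr_sub4_le (d0 - X 0 0 w) (a * (d1 - X (0 - 1) 0 w))
  (b * (d2 - X 0 (0 - 1) w)) (c * (d3 - X (0 - 1) (0 - 1) w)).
by rewrite eqw !exprMn; congr (_ <= _); ring.
Qed.

Lemma causal_recursion {d : measure_display} {T : measurableType d}
    {R : realType} {P : probability T R} (a b c sigma2 : R)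
    (eps X : int -> int -> {RV P >-> R}) (psi : nat -> nat -> R) :
  0 < sigma2 -> white_noise eps sigma2 ->
  {ae P, forall w, X 0 0 w = a * X (0 - 1) 0 w + b * X 0 (0 - 1) w
                + c * X (0 - 1) (0 - 1) w + eps 0 0 w} ->
  causal_representation X eps psi -> ar_recursion a b c psi.
Proof.
move=> s0 wn eqX repr.
have covS i j m n k l i' j' : (k < m)%N -> (l < n)%N -> i' = i - k%:Z -> j' = j - l%:Z ->
    covariance P (ma_partial_sum eps psi i j m n) (eps i' j') = (psi k l * sigma2)%:E.
  by move=> km ln -> ->; exact: covariance_ma_partial_sum.
have covS0 i j m n i' j' : (i < i') || (j < j') ->
    covariance P (ma_partial_sum eps psi i j m n) (eps i' j') = (0 * sigma2)%:E.
  by rewrite mul0r; exact: covariance_ma_partial_sum_future wn.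
have inn := causal_innovation_eq0 a b c sigma2 eps X psi _ _ _ s0 wn eqX repr.
split=> [|k|l|k l]; apply/eqP; rewrite -subr_eq0; apply/eqP.
- apply: (inn _ 0 0)%N => m n km ln /=.
  (* Witnesses are the covariances over [sigma2] of the partial sums at (0,0), (-1,0), (0,-1),
     (-1,-1), then of [eps 0 0]. A 0 for a partial sum marks noise in its future; the last entry is
     1 only for this clause. *)
  exists (psi 0 0)%N, 0, 0, 0, 1;
    split; try by [apply: covS; lia|apply: covS0; lia].
  by split; [rewrite (white_noise_covariance _ _ wn) eqxx|ring].
- apply: (inn _ k.+1 0)%N => m n km ln /=.
  exists (psi k.+1 0)%N, (psi k 0)%N, 0, 0, 0;
    split; try by [apply: covS; lia|apply: covS0; lia].
  split; last by ring.
  by rewrite (white_noise_covariance _ _ wn); case: eqP => // -[]; lia.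
- apply: (inn _ 0 l.+1)%N => m n km ln /=.
  exists (psi 0 l.+1)%N, 0, (psi 0 l)%N, 0, 0;
    split; try by [apply: covS; lia|apply: covS0; lia].
  split; last by ring.
  by rewrite (white_noise_covariance _ _ wn); case: eqP => // -[]; lia.
- apply: (inn _ k.+1 l.+1)%N => m n km ln /=.
  exists (psi k.+1 l.+1), (psi k l.+1), (psi k.+1 l), (psi k l), 0;
    split; try by [apply: covS; lia|apply: covS0; lia].
  split; last by ring.
  by rewrite (white_noise_covariance _ _ wn); case: eqP => // -[]; lia.
Qed.

Theorem proposition4 (d : measure_display) (T : measurableType d)
    (R : realType) (P : probability T R) (a b c sigma2 : R)
    (eps X : int -> int -> {RV P >-> R})
    (sigma2_gt0 : 0 < sigma2)
    (eps_white_noise : white_noise eps sigma2)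
    (X_stationary : wide_sense_stationary X)
    (X_equation : forall i j : int, {ae P, forall w,
      X i j w = a * X (i - 1) j w + b * X i (j - 1) w
                + c * X (i - 1) (j - 1) w + eps i j w}) :
  (causal X eps <->
    [/\ 0 < 1 - a - b - c, 0 < 1 - a + b + c,
        0 < 1 + a - b + c & 0 < 1 + a + b - c]) /\
  (forall psi : nat -> nat -> R, causal_representation X eps psi ->
    forall k l : nat,
      psi k l = \sum_(m < (minn k l).+1)
        'C(k, m)%:R * 'C(l, m)%:R * a ^+ (k - m) * b ^+ (l - m)
        * (a * b + c) ^+ m).
Proof.
(* Both claims rest on this: the recursion yields the inequalities through boundedness and the
   formula through uniqueness. *)
have rec psi (repr : causal_representation X eps psi) : ar_recursion a b c psi.
  exact: causal_recursion sigma2_gt0 eps_white_noise (X_equation 0 0) repr.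
split; last by move=> psi /rec /ar_recursion_unique; apply; exact: ar_coef_recursion.
split=> [[psi repr]|[h1 h2 h3 h4]].
  have [B leB] := absolutely_summable_bounded psi repr.1.
  exact: ar_bounded_inequalities (rec _ repr) leB.
by exists (ar_coef a b c); exact: causal_of_inequalities.
Qed.
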